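(* Let $\mathsf{X}$ be a subshift over an alphabet $\mathscr{A}$ and let $R$ be a commutative unital ring. Then there exists an $R$-algebra homomorphism $\pi:\widetilde{\mathcal{A}}_R(\mathsf{X})\to \mathrm{End}_R(\mathbb{P})$ such that $\pi(p_A)=P_A$, $\pi(s_a)=S_a$ and $\pi(s_a^* )=S_a^*$ for each $A\in\mathcal{U}$ and $a\in\mathscr{A}$.
   Context: $\mathbb{N}=\{0,1,2,\dots\}$. $\mathscr{A}$ is an arbitrary non-empty set (alphabet); $\sigma:\mathscr{A}^{\mathbb{N}}\to\mathscr{A}^{\mathbb{N}}$ is the shift $\sigma(x_1x_2x_3\dots)=x_2x_3\dots$. $\mathscr{A}^*$ is the set of finite words, including the empty word $\omega$. For $F\subseteq\mathscr{A}^*$, the subshift $\mathsf{X}=\mathsf{X}_F$ is the set of all sequences in $\mathscr{A}^{\mathbb{N}}$ no finite (contiguous) subword of which belongs to $F$. The language $\mathcal{L}_{\mathsf{X}}$ is the set of all finite words (including $\omega$) appearing in some element of $\mathsf{X}$. For $\alpha,\beta\in\mathcal{L}_{\mathsf{X}}$ let $C(\alpha,\beta)=\{\beta x\in\mathsf{X}:\alpha x\in\mathsf{X}\}$. $\mathcal{U}$ is the Boolean algebra of subsets of $\mathsf{X}$ generated by all $C(\alpha,\beta)$, $\alpha,\beta\in\mathcal{L}_{\mathsf{X}}$ (finite unions, finite intersections, complements in $\mathsf{X}$). The unital subshift algebra $\widetilde{\mathcal{A}}_R(\mathsf{X})$ is the universal unital $R$-algebra with generators $\{p_A:A\in\mathcal{U}\}$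 and $\{s_a,s_a^*:a\in\mathscr{A}\}$ subject to: (i) $p_{\mathsf{X}}=1$, $p_{A\cap B}=p_Ap_B$, $p_{A\cup B}=p_A+p_B-p_{A\cap B}$, $p_\emptyset=0$ for all $A,B\in\mathcal{U}$; (ii) $s_as_a^*s_a=s_a$ and $s_a^*s_as_a^*=s_a^*$ for all $a\in\mathscr{A}$; (iii) $s_\beta s_\alpha^*s_\alpha s_\beta^*=p_{C(\alpha,\beta)}$ for all $\alpha,\beta\in\mathcal{L}_{\mathsf{X}}$, where $s_\omega=s_\omega^*=1$ and, for $\alpha=\alpha_1\cdots\alpha_n$, $s_\alpha=s_{\alpha_1}\cdots s_{\alpha_n}$, $s_\alpha^*=s_{\alpha_n}^*\cdots s_{\alpha_1}^*$. $\mathbb{P}$ is the free $R$-module with basis $\{\delta_x:x\in\mathsf{X}\}$, and $\mathrm{End}_R(\mathbb{P})$ is the $R$-algebra of its $R$-module endomorphisms. For a statement $p$, $[p]=1$ if $p$ is true and $[p]=0$ otherwise. For $A\in\mathcal{U}$, $a\in\mathscr{A}$, define $R$-linear maps $P_A,S_a,S_a^*:\mathbb{P}\to\mathbb{P}$ on basis elements, $x=x_1x_2x_3\dots\in\mathsf{X}$, by $P_A(\delta_x)=[x\in A]\,\delta_x$, $S_a(\delta_x)=[ax\in\mathsf{X}]\,\delta_{ax}$, $S_a^*(\delta_x)=[x_1=a]\,\delta_{\sigma(x)}$ (the value being $0$ when the bracket is $0$). *)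

(* Defs.v *)
From HB Require Import structures.
From mathcomp Require Import all_boot all_algebra.
From mathcomp Require Import generic_quotient finmap.
From mathcomp Require Import boolp classical_sets functions cardinality.

Set Implicit Arguments.
Unset Strict Implicit.
Unset Printing Implicit Defensive.

Import GRing.Theory.

Local Open Scope classical_set_scope.
Local Open Scope ring_scope.

Section LinearZmodule.
Context (R : pzRingType) (V W : lmodType R).

HB.instance Definition _ := gen_eqMixin {linear V -> W}.
HB.instance Definition _ := gen_choiceMixin {linear V -> W}.

Lemma linear_ext (f g : {linear V -> W}) : f =1 g -> f = g.
Proof.
case: f g => [f cf] [g cg] /= /funext fg; move: cf cg; rewrite fg => cf cg.
congr (GRing.Linear.Pack _); case: cf cg => [[a] [b]] [[a'] [b']].
by do ?f_equal; exact: Prop_irrelevance.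
Qed.

Definition lin_zero : {linear V -> W} := \0.
Definition lin_add (f g : {linear V -> W}) : {linear V -> W} := f \+ g.
Definition lin_opp (f : {linear V -> W}) : {linear V -> W} := \- f.

Fact lin_addA : associative lin_add.
Proof. by move=> f g h; apply: linear_ext => x /=; rewrite addrA. Qed.
Fact lin_addC : commutative lin_add.
Proof. by move=> f g; apply: linear_ext => x /=; rewrite addrC. Qed.
Fact lin_add0 : left_id lin_zero lin_add.
Proof. by move=> f; apply: linear_ext => x /=; rewrite add0r. Qed.
Fact lin_addN : left_inverse lin_zero lin_opp lin_add.
Proof. by move=> f; apply: linear_ext => x /=; rewrite addNr. Qed.

HB.instance Definition _ := GRing.isZmodule.Build {linear V -> W}
  lin_addA lin_addC lin_add0 lin_addN.

End LinearZmodule.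

Section EndPzRing.
Context (R : pzRingType) (V : lmodType R).

Definition end_one : {linear V -> V} := idfun.
Definition end_mul (f g : {linear V -> V}) : {linear V -> V} := f \o g.

Fact end_mulA : associative end_mul.
Proof. by move=> f g h; apply: linear_ext. Qed.
Fact end_mul1l : left_id end_one end_mul.
Proof. by move=> f; apply: linear_ext. Qed.
Fact end_mul1r : right_id end_one end_mul.
Proof. by move=> f; apply: linear_ext. Qed.
Fact end_mulDl : left_distributive end_mul +%R.
Proof. by move=> f g h; apply: linear_ext. Qed.
Fact end_mulDr : right_distributive end_mul +%R.
Proof. by move=> f g h; apply: linear_ext => x; rewrite /= linearD. Qed.

HB.instance Definition _ := GRing.Zmodule_isPzRing.Build {linear V -> V}
  end_mulA end_mul1l end_mul1r end_mulDl end_mulDr.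

End EndPzRing.

Section EndPzAlgebra.
Context (R : comPzRingType) (V : lmodType R).

Definition end_scale (k : R) (f : {linear V -> V}) : {linear V -> V} := k \*: f.

Fact end_scaleA a b f : end_scale a (end_scale b f) = end_scale (a * b) f.
Proof. by apply: linear_ext => x; rewrite /= scalerA. Qed.
Fact end_scale1 : left_id 1 end_scale.
Proof. by move=> f; apply: linear_ext => x; rewrite /= scale1r. Qed.
Fact end_scaleDr : right_distributive end_scale +%R.
Proof. by move=> a f g; apply: linear_ext => x; rewrite /= scalerDr. Qed.
Fact end_scaleDl f : {morph end_scale^~ f : a b / a + b}.
Proof. by move=> a b; apply: linear_ext => x; rewrite /= scalerDl. Qed.

HB.instance Definition _ := GRing.Zmodule_isLmodule.Build R {linear V -> V}
  end_scaleA end_scale1 end_scaleDr end_scaleDl.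

Fact end_scaleAl (k : R) (f g : {linear V -> V}) : k *: (f * g) = (k *: f) * g.
Proof. by apply: linear_ext. Qed.
Fact end_scaleAr (k : R) (f g : {linear V -> V}) : k *: (f * g) = f * (k *: g).
Proof. by apply: linear_ext => x; rewrite /= linearZ. Qed.

End EndPzAlgebra.

(* R^o rather than R: the pointwise module structure on T -> R is only found
   through the regular module R^o. *)
Section FreeModule.
Context (R : pzRingType) (T : Type).

Definition fin_supp : {pred T -> R^o} :=
  fun f => `[< finite_set [set t | f t != 0] >].

Fact fin_supp_submod : subsemimod_closed fin_supp.
Proof.
split; [split|].
- apply/asboolP; rewrite (_ : [set _ | _] = set0); first exact: finite_set0.
  by apply/seteqP; split=> t //=; rewrite eqxx.
- move=> f g /asboolP ff /asboolP fg; apply/asboolP.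
  apply: (@sub_finite_set _ _ ([set t | f t != 0] `|` [set t | g t != 0])).
    move=> t /=; case: (eqVneq (f t) 0) => [f0|]; last by left.
    by rewrite /GRing.add /= f0 add0r; right.
  by rewrite finite_setU.
- move=> a f /asboolP ff; apply/asboolP; apply: sub_finite_set ff => t /=.
  apply: contra_neq => f0; rewrite /GRing.scale /= f0; exact: mulr0.
Qed.

Record free_module : Type := FreeModule {
  free_coef :> T -> R^o;
  _ : free_coef \in fin_supp
}.

HB.instance Definition _ := [isSub for free_coef].
HB.instance Definition _ := [Choice of free_module by <:].
HB.instance Definition _ :=
  GRing.SubChoice_isSubLmodule.Build R (T -> R^o) fin_supp free_module
    fin_supp_submod.

Fact delta_fin_supp (t : T) :
  (fun u => (`[< u = t >])%:R : R^o) \in fin_supp.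
Proof.
apply/asboolP; apply: (@sub_finite_set _ _ [set t]); last exact: finite_set1.
by move=> u /=; case: asboolP => //=; rewrite eqxx.
Qed.

Definition delta (t : T) : free_module := FreeModule (delta_fin_supp t).

Definition supp (f : free_module) : {fset {classic T}} :=
  fset_set ([set t | f t != 0] : set {classic T}).

Lemma in_supp (f : free_module) t : (t \in supp f) = (f t != 0).
Proof.
rewrite in_fset_set; first by apply/idP/idP => [/set_mem|/mem_set].
by case: f => f /= /asboolP.
Qed.

Variables (V : lmodType R) (g : T -> V).

Definition lin_ext_fun (f : free_module) : V := \sum_(t <- supp f) (f t : R) *: g t.

Lemma lin_ext_funE (f : free_module) (A : {fset {classic T}}) :
  {subset supp f <= A} -> lin_ext_fun f = \sum_(t <- A) (f t : R) *: g t.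
Proof.
move=> fA; apply: big_fset_incl; first exact/fsubsetP.
by move=> t _; rewrite in_supp negbK => /eqP ->; rewrite scale0r.
Qed.

Fact lin_ext_is_linear : linear lin_ext_fun.
Proof.
move=> a f h; pose A := (supp f `|` supp h)%fset.
have fA : {subset supp f <= A} by move=> t tf; rewrite in_fsetU tf.
have hA : {subset supp h <= A} by move=> t th; rewrite in_fsetU th orbT.
have fhE t : (a *: f + h) t = a * f t + h t by [].
have fhA : {subset supp (a *: f + h) <= A}.
  move=> t; rewrite in_fsetU !in_supp fhE; apply: contraR.
  by rewrite negb_or !negbK => /andP[/eqP -> /eqP ->]; rewrite mulr0 addr0.
rewrite (lin_ext_funE fA) (lin_ext_funE hA) (lin_ext_funE fhA).
rewrite scaler_sumr -big_split; apply: eq_bigr => t _.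
by rewrite fhE scalerDl -scalerA.
Qed.

HB.instance Definition _ :=
  GRing.isLinear.Build R free_module V *:%R lin_ext_fun lin_ext_is_linear.

(* The linear map with prescribed values on the basis: see [lin_ext_delta]
   and [lin_ext_unique]. *)
Definition lin_ext : {linear free_module -> V} := lin_ext_fun.

Lemma lin_ext_delta t : lin_ext (delta t) = g t.
Proof.
rewrite /lin_ext /= (@lin_ext_funE _ [fset (t : {classic T})]%fset).
  by rewrite big_seq_fset1 /= asboolT// scale1r.
move=> u; rewrite in_supp in_fset1 /=; case: asboolP => [-> _|]; first exact/eqP.
by rewrite eqxx.
Qed.

Lemma free_decomp (f : free_module) :
  f = \sum_(t <- supp f) (f t : R) *: delta t.
Proof.
apply/val_inj/funext => u; rewrite raddf_sum fct_sumE.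
rewrite (eq_bigr (fun t : {classic T} => (f t : R) * (`[< u = t >])%:R)) //.
case: (boolP ((u : {classic T}) \in supp f)) => [uf|/[dup] uf].
  rewrite (big_fsetD1 _ uf) /= asboolT// mulr1 big_seq big1 ?addr0//.
  move=> t; rewrite in_fsetD1 => /andP[/eqP tu _].
  by rewrite asboolF ?mulr0// => ut; apply: tu.
rewrite in_supp negbK => /eqP fu0; rewrite [LHS]fu0 big_seq big1// => t tf.
by rewrite asboolF ?mulr0// => ut; move: uf; rewrite ut tf.
Qed.

Lemma lin_ext_unique (h : {linear free_module -> V}) :
  (forall t, h (delta t) = g t) -> h = lin_ext.
Proof.
move=> hg; apply: linear_ext => f; rewrite (free_decomp f) !linear_sum.
by apply: eq_bigr => t _; rewrite !linearZ /= hg -[g t]lin_ext_delta.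
Qed.

End FreeModule.

(* The unital R-algebra with generators G and relations rel is built as the
   terms in the algebra operations modulo the least congruence containing the
   algebra axioms and rel; [presented_lift] is its universal property.
   It gets separate pzRingType and lmodType R structures (compatible by
   [presented_scaleAl] and [presented_scaleAr]), not an [algType R]: that
   interface excludes the zero ring, which does occur, e.g. when R is zero or
   when the subshift is empty. *)

Inductive alg_term (R G : Type) : Type :=
| TGen of G
| TZero
| TOne
| TAdd of alg_term R G & alg_term R G
| TOpp of alg_term R G
| TMul of alg_term R G & alg_term R G
| TScale of R & alg_term R G.

Arguments TGen {R G}.
Arguments TZero {R G}.
Arguments TOne {R G}.

Declare Scope alg_term_scope.
Delimit Scope alg_term_scope with T.
Bind Scope alg_term_scope with alg_term.
Notation "0" := TZero : alg_term_scope.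
Notation "1" := TOne : alg_term_scope.
Notation "x + y" := (TAdd x y) : alg_term_scope.
Notation "- x" := (TOpp x) : alg_term_scope.
Notation "x - y" := (TAdd x (TOpp y)) : alg_term_scope.
Notation "x * y" := (TMul x y) : alg_term_scope.
Notation "a *: x" := (TScale a x) : alg_term_scope.

Section Presentation.
Context (R : comPzRingType) (G : Type).
Implicit Types (a b : R) (x y z : alg_term R G).
Context (rel : alg_term R G -> alg_term R G -> Prop).

Inductive alg_cong : alg_term R G -> alg_term R G -> Prop :=
| cong_rel x y : rel x y -> alg_cong x y
| cong_refl x : alg_cong x x
| cong_sym x y : alg_cong x y -> alg_cong y x
| cong_trans x y z : alg_cong x y -> alg_cong y z -> alg_cong x z
| cong_add x x' y y' :
    alg_cong x x' -> alg_cong y y' -> alg_cong (x + y)%T (x' + y')%T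
| cong_opp x x' : alg_cong x x' -> alg_cong (- x)%T (- x')%T
| cong_mul x x' y y' :
    alg_cong x x' -> alg_cong y y' -> alg_cong (x * y)%T (x' * y')%T
| cong_scale a x x' : alg_cong x x' -> alg_cong (a *: x)%T (a *: x')%T
| cong_addA x y z : alg_cong (x + (y + z))%T (x + y + z)%T
| cong_addC x y : alg_cong (x + y)%T (y + x)%T
| cong_add0 x : alg_cong (0 + x)%T x
| cong_addN x : alg_cong (- x + x)%T 0%T
| cong_mulA x y z : alg_cong (x * (y * z))%T (x * y * z)%T
| cong_mul1l x : alg_cong (1 * x)%T x
| cong_mul1r x : alg_cong (x * 1)%T x
| cong_mulDl x y z : alg_cong ((x + y) * z)%T (x * z + y * z)%T
| cong_mulDr x y z : alg_cong (x * (y + z))%T (x * y + x * z)%T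
| cong_scaleA a b x : alg_cong (a *: (b *: x))%T ((a * b)%R *: x)%T
| cong_scale1 x : alg_cong (1%R *: x)%T x
| cong_scaleDr a x y : alg_cong (a *: (x + y))%T (a *: x + a *: y)%T
| cong_scaleDl x a b : alg_cong ((a + b)%R *: x)%T (a *: x + b *: x)%T
| cong_scaleAl a x y : alg_cong (a *: (x * y))%T ((a *: x) * y)%T
| cong_scaleAr a x y : alg_cong (a *: (x * y))%T (x * (a *: y))%T.

Definition alg_congb (x y : {classic alg_term R G}) : bool :=
  `[< alg_cong x y >].

Fact alg_congb_equiv : equiv_class_of alg_congb.
Proof.
split.
- by move=> x; apply/asboolP; exact: cong_refl.
- by move=> x y; apply/asboolP/asboolP; exact: cong_sym.
- move=> y x z /asboolP xy /asboolP yz; apply/asboolP.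
  exact: cong_trans xy yz.
Qed.

Canonical alg_cong_equiv := EquivRelPack alg_congb_equiv.

Definition presented := {eq_quot alg_cong_equiv}%qT.
HB.instance Definition _ := Choice.on presented.
HB.instance Definition _ := EqQuotient.on presented.

Definition pclass (x : alg_term R G) : presented :=
  (\pi_presented (x : {classic alg_term R G}))%qT.

Definition prep (u : presented) : alg_term R G := repr u.

Definition presented_gen (g : G) : presented := pclass (TGen g).

Lemma prepK u : pclass (prep u) = u.
Proof. exact: reprK. Qed.

Lemma pclassE x y : alg_cong x y <-> pclass x = pclass y.
Proof.
split=> [xy|/eqmodP/asboolP//]; apply/eqmodP/asboolP; exact: xy.
Qed.

Lemma prep_pclass x : alg_cong (prep (pclass x)) x.
Proof. by apply/pclassE; rewrite prepK. Qed.

Definition padd u v := pclass (prep u + prep v)%T.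
Definition popp u := pclass (- prep u)%T.
Definition pmul u v := pclass (prep u * prep v)%T.
Definition pscale a u := pclass (a *: prep u)%T.

Lemma paddE x y : padd (pclass x) (pclass y) = pclass (x + y)%T.
Proof. by apply/pclassE/cong_add; exact: prep_pclass. Qed.
Lemma poppE x : popp (pclass x) = pclass (- x)%T.
Proof. by apply/pclassE/cong_opp; exact: prep_pclass. Qed.
Lemma pmulE x y : pmul (pclass x) (pclass y) = pclass (x * y)%T.
Proof. by apply/pclassE/cong_mul; exact: prep_pclass. Qed.
Lemma pscaleE a x : pscale a (pclass x) = pclass (a *: x)%T.
Proof. by apply/pclassE/cong_scale; exact: prep_pclass. Qed.

Let pE := (paddE, poppE, pmulE, pscaleE).

Fact paddA : associative padd.
Proof.
move=> u v w; rewrite -(prepK u) -(prepK v) -(prepK w) !pE.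
exact/pclassE/cong_addA.
Qed.
Fact paddC : commutative padd.
Proof. by move=> u v; exact/pclassE/cong_addC. Qed.
Fact padd0 : left_id (pclass 0%T) padd.
Proof. by move=> u; rewrite -(prepK u) pE; exact/pclassE/cong_add0. Qed.
Fact paddN : left_inverse (pclass 0%T) popp padd.
Proof. by move=> u; rewrite -(prepK u) !pE; exact/pclassE/cong_addN. Qed.
HB.instance Definition _ :=
  GRing.isZmodule.Build presented paddA paddC padd0 paddN.

Fact pmulA : associative pmul.
Proof.
move=> u v w; rewrite -(prepK u) -(prepK v) -(prepK w) !pE.
exact/pclassE/cong_mulA.
Qed.
Fact pmul1l : left_id (pclass 1%T) pmul.
Proof. by move=> u; rewrite -(prepK u) pE; exact/pclassE/cong_mul1l. Qed.
Fact pmul1r : right_id (pclass 1%T) pmul.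
Proof. by move=> u; rewrite -(prepK u) pE; exact/pclassE/cong_mul1r. Qed.
Fact pmulDl : left_distributive pmul +%R.
Proof.
move=> u v w; rewrite -(prepK u) -(prepK v) -(prepK w) /GRing.add /= !pE.
exact/pclassE/cong_mulDl.
Qed.
Fact pmulDr : right_distributive pmul +%R.
Proof.
move=> u v w; rewrite -(prepK u) -(prepK v) -(prepK w) /GRing.add /= !pE.
exact/pclassE/cong_mulDr.
Qed.
HB.instance Definition _ := GRing.Zmodule_isPzRing.Build presented
  pmulA pmul1l pmul1r pmulDl pmulDr.

Fact pscaleA a b u : pscale a (pscale b u) = pscale (a * b) u.
Proof. by rewrite -(prepK u) !pE; exact/pclassE/cong_scaleA. Qed.
Fact pscale1 : left_id 1 pscale.
Proof. by move=> u; rewrite -(prepK u) pE; exact/pclassE/cong_scale1. Qed.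
Fact pscaleDr : right_distributive pscale +%R.
Proof.
move=> a u v; rewrite -(prepK u) -(prepK v) /GRing.add /= !pE.
exact/pclassE/cong_scaleDr.
Qed.
Fact pscaleDl u : {morph pscale^~ u : a b / a + b}.
Proof.
move=> a b; rewrite -(prepK u) /= [RHS]/GRing.add /= !pE.
exact/pclassE/cong_scaleDl.
Qed.
HB.instance Definition _ := GRing.Zmodule_isLmodule.Build R presented
  pscaleA pscale1 pscaleDr pscaleDl.

Lemma presented_scaleAl a (u v : presented) : a *: (u * v) = (a *: u) * v.
Proof.
rewrite -(prepK u) -(prepK v) /GRing.mul /GRing.scale /= !pE.
exact/pclassE/cong_scaleAl.
Qed.
Lemma presented_scaleAr a (u v : presented) : a *: (u * v) = u * (a *: v).
Proof.
rewrite -(prepK u) -(prepK v) /GRing.mul /GRing.scale /= !pE.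
exact/pclassE/cong_scaleAr.
Qed.

(* A unital R-algebra structure on a ring B is a ring morphism i from R to the
   centre of B, with a *: b = i a * b. *)
Section Lift.
Context (B : pzRingType) (i : {rmorphism R -> B}).
Hypothesis i_central : forall a (b : B), i a * b = b * i a.
Context (v : G -> B).

Fixpoint eval x : B := match x with
  | TGen g => v g
  | TZero => 0
  | TOne => 1
  | TAdd x y => eval x + eval y
  | TOpp x => - eval x
  | TMul x y => eval x * eval y
  | TScale a x => i a * eval x
  end.

Hypothesis v_rel : forall x y, rel x y -> eval x = eval y.

Lemma eval_cong x y : alg_cong x y -> eval x = eval y.
Proof.
elim=> //=; try by move=> *; congruence.
- by move=> *; rewrite addrA.
- by move=> *; rewrite addrC.
- by move=> *; rewrite add0r.
- by move=> *; rewrite addNr.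
- by move=> *; rewrite mulrA.
- by move=> *; rewrite mul1r.
- by move=> *; rewrite mulr1.
- by move=> *; rewrite mulrDl.
- by move=> *; rewrite mulrDr.
- by move=> *; rewrite rmorphM mulrA.
- by move=> *; rewrite rmorph1 mul1r.
- by move=> *; rewrite mulrDr.
- by move=> *; rewrite rmorphD mulrDl.
- by move=> *; rewrite mulrA.
- by move=> a y1 z1; rewrite mulrA i_central !mulrA.
Qed.

Lemma presented_lift : exists! f : presented -> B,
  [/\ {morph f : x y / x + y}, {morph f : x y / x * y}, f 1 = 1,
      (forall a u, f (a *: u) = i a * f u) &
      (forall g, f (presented_gen g) = v g)].
Proof.
have fE x : eval (prep (pclass x)) = eval x by exact/eval_cong/prep_pclass.
exists (eval \o prep); split.
  by split=> [x y|x y||a u|g] /=; rewrite ?[_ + _]/(padd _ _) ?fE.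
move=> f [fD fM f1 fZ fG]; apply/funext => u /=; rewrite -[in RHS](prepK u).
have f0 : f 0 = 0 by apply: (addIr (f 0)); rewrite -fD !add0r.
have fN w : f (- w) = - f w.
  by apply/eqP; rewrite -addr_eq0 -fD addNr f0.
elim: (prep u) => /= [g|||x -> y ->|x ->|x -> y ->|a x ->].
- by rewrite -fG.
- by rewrite -f0.
- by rewrite -f1.
- by rewrite -fD [X in f X]paddE.
- by rewrite -fN [X in f X]poppE.
- by rewrite -fM [X in f X]pmulE.
- by rewrite -fZ [X in f X]pscaleE.
Qed.

End Lift.

End Presentation.

(* A sequence x_1 x_2 x_3 ... is the function n |-> x_(n+1). *)

Section Subshift.
Context {A : Type}.
Implicit Types (x y : nat -> A) (a : A) (w u v : seq A).

Definition shift x : nat -> A := fun n => x n.+1.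

(* The concatenation w x: the default value of nth is used past the end of w. *)
Definition app w x : nat -> A := fun n => nth (x (n - size w)%N) w n.

Lemma app0 x : app [::] x = x.
Proof. by apply/funext => n; rewrite /app nth_nil subn0. Qed.

Lemma app1 a x : app [:: a] x = fun n => if n is m.+1 then x m else a.
Proof. by apply/funext => -[|n]//; rewrite /app /= nth_nil subn1. Qed.

Definition subword w x : Prop :=
  exists k, w = mkseq (fun n => x (k + n)%N) (size w).

Context (F : set (seq A)).

Definition subshift : set (nat -> A) :=
  [set x | forall w, subword w x -> ~ F w].

Definition language : set (seq A) :=
  [set w | exists2 x, subshift x & subword w x].

(* C(u, v) = {v x in X : u x in X}. *)
Definition cyl (u v : seq A) : set (nat -> A) :=
  [set app v x | x in [set x | subshift (app v x) /\ subshift (app u x)]].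

Inductive in_boolean_algebra : set (nat -> A) -> Prop :=
| bool_cyl u v : language u -> language v -> in_boolean_algebra (cyl u v)
| bool_top : in_boolean_algebra subshift
| bool_empty : in_boolean_algebra set0
| bool_setI Y Z : in_boolean_algebra Y -> in_boolean_algebra Z ->
    in_boolean_algebra (Y `&` Z)
| bool_setU Y Z : in_boolean_algebra Y -> in_boolean_algebra Z ->
    in_boolean_algebra (Y `|` Z)
| bool_setC Y : in_boolean_algebra Y -> in_boolean_algebra (subshift `\` Y).

Definition boolean_algebra : Type :=
  {Y : set (nat -> A) | in_boolean_algebra Y}.

Definition Ucyl u v (hu : language u) (hv : language v) : boolean_algebra :=
  exist _ _ (bool_cyl hu hv).
Definition Utop : boolean_algebra := exist _ _ bool_top.
Definition Uempty : boolean_algebra := exist _ _ bool_empty.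
Definition UsetI (Y Z : boolean_algebra) : boolean_algebra :=
  exist _ _ (bool_setI (proj2_sig Y) (proj2_sig Z)).
Definition UsetU (Y Z : boolean_algebra) : boolean_algebra :=
  exist _ _ (bool_setU (proj2_sig Y) (proj2_sig Z)).

Lemma boolean_algebra_sub (Y : boolean_algebra) : proj1_sig Y `<=` subshift.
Proof.
case: Y => Y /=; elim=> {Y} //.
- by move=> u v _ _ _ [x [hx _] <-].
- by move=> Y Z _ YX _ _ x [/YX].
- by move=> Y Z _ YX _ ZX x [/YX|/ZX].
Qed.

Inductive subshift_gen : Type :=
| GenP of boolean_algebra
| GenS of A
| GenSs of A.

Section SubshiftAlgebra.
Context (R : comPzRingType).

Local Notation term := (alg_term R subshift_gen).
Local Notation p Y := (TGen (GenP Y) : term).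
Local Notation s a := (TGen (GenS a) : term).
Local Notation ss a := (TGen (GenSs a) : term).

Definition s_word w : term := foldr (fun a t => s a * t)%T 1%T w.
Definition ss_word w : term := foldr (fun a t => ss a * t)%T 1%T (rev w).

Inductive subshift_rel : term -> term -> Prop :=
| rel_top : subshift_rel (p Utop) 1%T
| rel_setI Y Z : subshift_rel (p (UsetI Y Z)) (p Y * p Z)%T
| rel_setU Y Z : subshift_rel (p (UsetU Y Z)) (p Y + p Z - p (UsetI Y Z))%T
| rel_empty : subshift_rel (p Uempty) 0%T
| rel_s a : subshift_rel (s a * ss a * s a)%T (s a)
| rel_ss a : subshift_rel (ss a * s a * ss a)%T (ss a)
| rel_cyl u v (hu : language u) (hv : language v) :
    subshift_rel (s_word v * ss_word u * s_word u * ss_word v)%T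
                 (p (Ucyl hu hv)).

Definition subshift_algebra := presented subshift_rel.
HB.instance Definition _ := GRing.PzRing.on subshift_algebra.
HB.instance Definition _ := GRing.Lmodule.on subshift_algebra.

Definition alg_p (Y : boolean_algebra) : subshift_algebra :=
  presented_gen subshift_rel (GenP Y).
Definition alg_s a : subshift_algebra := presented_gen subshift_rel (GenS a).
Definition alg_ss a : subshift_algebra := presented_gen subshift_rel (GenSs a).

Definition point : Type := {x : nat -> A | subshift x}.

Lemma subshift_shift x : subshift x -> subshift (shift x).
Proof.
move=> hx w [k wE]; apply: hx; exists k.+1; rewrite {1}wE.
by apply: eq_mkseq => n; rewrite /shift addSn.
Qed.

Definition point_shift (x : point) : point :=
  exist _ _ (subshift_shift (proj2_sig x)).

Definition PP := free_module R point.
HB.instance Definition _ := GRing.Lmodule.on PP.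

Definition P_op (Y : boolean_algebra) : {linear PP -> PP} :=
  lin_ext (fun x : point =>
    if pselect (proj1_sig Y (proj1_sig x)) then delta R x else 0 : PP).

Definition S_op a : {linear PP -> PP} :=
  lin_ext (fun x : point =>
    match pselect (subshift (app [:: a] (proj1_sig x))) with
    | left ax_in => delta R (exist _ _ ax_in : point) : PP
    | right _ => 0
    end).

Definition Ss_op a : {linear PP -> PP} :=
  lin_ext (fun x : point =>
    if pselect (proj1_sig x 0%N = a) then delta R (point_shift x) else 0 : PP).

End SubshiftAlgebra.

End Subshift.

Arguments boolean_algebra {A} F.
Arguments subshift_algebra {A} F R.
Arguments PP {A} F R.
Arguments alg_p {A F} R Y.
Arguments alg_s {A} F R a.
Arguments alg_ss {A} F R a.
Arguments P_op {A F} R Y.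
Arguments S_op {A} F R a.
Arguments Ss_op {A} F R a.

(* Main.v *)
(** By the universal property of the presentation it suffices to check the
defining relations for the operators, and by linearity to check them on basis
elements.  For words one gets S_w delta_y = delta_(wy) if wy lies in X and 0
otherwise, while S_w^* sends delta_(wy) to delta_y and kills delta_x when x does
not begin with w.  Hence S_v S_u^* S_u S_v^* fixes delta_x when x = vy with
uy in X, and kills it otherwise: this is P_C(u,v). *)

Require Import Defs.
From mathcomp Require Import all_boot all_algebra.
From mathcomp Require Import classical_sets.
From HB Require Import structures.
From mathcomp Require Import boolp.

Import GRing.Theory.
Local Open Scope ring_scope.

Section EndScalar.
Context (R : comPzRingType) (V : lmodType R).

(** The structure map from R to the centre of the endomorphism ring: [presented_lift] describes an
    R-algebra by such a ring morphism. *)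
Definition end_scalar (a : R) : {linear V -> V} := a *: (1 : {linear V -> V}).

Fact end_scalar_zmod : zmod_morphism end_scalar.
Proof. by move=> a b; rewrite /end_scalar scalerBl. Qed.

Fact end_scalar_monoid : monoid_morphism end_scalar.
Proof.
split=> [|a b]; first by rewrite /end_scalar scale1r.
by rewrite /end_scalar -end_scaleAl mul1r scalerA.
Qed.

HB.instance Definition _ :=
  GRing.isZmodMorphism.Build R {linear V -> V} end_scalar end_scalar_zmod.
HB.instance Definition _ :=
  GRing.isMonoidMorphism.Build R {linear V -> V} end_scalar end_scalar_monoid.

Lemma end_scalarE a f : end_scalar a * f = a *: f.
Proof. by rewrite /end_scalar -end_scaleAl mul1r. Qed.

Lemma end_addE (f g : {linear V -> V}) x : (f + g) x = f x + g x.
Proof. by []. Qed.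

Lemma end_oppE (f : {linear V -> V}) x : (- f) x = - f x.
Proof. by []. Qed.

Lemma end_mulE (f g : {linear V -> V}) x : (f * g) x = f (g x).
Proof. by []. Qed.

Lemma end_scalar_central a f : end_scalar a * f = f * end_scalar a.
Proof. by rewrite end_scalarE /end_scalar -end_scaleAr mulr1. Qed.

End EndScalar.

Section Words.
Context {A : Type}.
Implicit Types (x : nat -> A) (a : A) (w : seq A).

Lemma app_cons a w x : app (a :: w) x = app [:: a] (app w x).
Proof. by rewrite app1; apply/funext => -[|n]. Qed.

Lemma shift_app1 a x : shift (app [:: a] x) = x.
Proof. by rewrite app1. Qed.

Lemma app1_shift x : app [:: x 0%N] (shift x) = x.
Proof. by rewrite app1; apply/funext => -[]. Qed.

End Words.

Section Representation.
Set Implicit Arguments.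
Unset Strict Implicit.
Context (A : Type) (F : set (seq A)) (R : comPzRingType).
Implicit Types (x y : nat -> A) (a : A) (u v w : seq A).

Local Notation X := (subshift F).
Local Notation End := {linear PP F R -> PP F R}.

(* Extending delta by 0 outside X lets the formula S_a delta_x = delta_(ax)
   hold without a bracket, since ax in X forces x in X. *)
Definition delta0 x : PP F R :=
  match pselect (X x) with
  | left hx => delta R (exist _ x hx : Defs.point F)
  | right _ => 0
  end.

Lemma delta0_out x : ~ X x -> delta0 x = 0.
Proof. by rewrite /delta0; case: pselect. Qed.

Lemma delta0_in x (hx : X x) : delta0 x = delta R (exist _ x hx : Defs.point F).
Proof.
by rewrite /delta0; case: pselect => // hx'; rewrite (Prop_irrelevance hx' hx).
Qed.

(** The [delta0 x] with x in X form the basis, and both maps are the unique linear extension of the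
    values of [g] on it. *)
Lemma end_ext (f g : End) :
  (forall x, X x -> f (delta0 x) = g (delta0 x)) -> f = g.
Proof.
move=> fg; rewrite (@lin_ext_unique _ _ _ (fun t => g (delta R t)) f).
  by apply/esym/lin_ext_unique.
by case=> x hx; rewrite -delta0_in; exact: fg.
Qed.

Lemma P_op_in (Y : boolean_algebra F) x :
  proj1_sig Y x -> P_op R Y (delta0 x) = delta0 x.
Proof.
move=> Yx; have hx := boolean_algebra_sub Yx.
rewrite (delta0_in hx) lin_ext_delta /=.
by case: pselect.
Qed.

Lemma P_op_out (Y : boolean_algebra F) x :
  ~ proj1_sig Y x -> P_op R Y (delta0 x) = 0.
Proof.
move=> Yx; have [hx|hx] := pselect (X x); last by rewrite delta0_out ?linear0.
rewrite (delta0_in hx) lin_ext_delta /=.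
by case: pselect.
Qed.

Lemma S_opE a x : S_op F R a (delta0 x) = delta0 (app [:: a] x).
Proof.
have [hx|hx] := pselect (X x).
  by rewrite {1}(delta0_in hx) lin_ext_delta.
rewrite !delta0_out ?linear0// => hax.
by apply: hx; rewrite -(shift_app1 a x); exact: subshift_shift.
Qed.

Lemma Ss_op_cons a x :
  X (app [:: a] x) -> Ss_op F R a (delta0 (app [:: a] x)) = delta0 x.
Proof.
move=> hx; rewrite (delta0_in hx) lin_ext_delta /=.
case: pselect => /= [_|]; last by rewrite app1.
by rewrite -delta0_in /= shift_app1.
Qed.

Lemma Ss_op_out a x : x 0%N <> a -> Ss_op F R a (delta0 x) = 0.
Proof.
move=> xa; have [hx|hx] := pselect (X x); last by rewrite delta0_out ?linear0.
rewrite (delta0_in hx) lin_ext_delta /=.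
by case: pselect.
Qed.

Definition gen_op (g : subshift_gen F) : End :=
  match g with
  | GenP Y => P_op R Y
  | GenS a => S_op F R a
  | GenSs a => Ss_op F R a
  end.

Local Notation ev := (eval (@end_scalar R (PP F R)) gen_op).

Lemma eval_s_word w x : ev (s_word F R w) (delta0 x) = delta0 (app w x).
Proof.
elim: w => [|a w IH]; first by rewrite app0.
by rewrite app_cons -S_opE -IH.
Qed.

(** [ss_word] folds over the reversed word, so the first letter is the rightmost factor and acts
    first. *)
Lemma eval_ss_word_cons a w :
  ev (ss_word F R (a :: w)) = ev (ss_word F R w) * Ss_op F R a.
Proof.
rewrite /ss_word rev_cons foldr_rcons.
by elim: (rev w) => [|b l IH] /=; rewrite ?mul1r ?mulr1// IH mulrA.
Qed.

Lemma eval_ss_word_app w x :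
  X (app w x) -> ev (ss_word F R w) (delta0 (app w x)) = delta0 x.
Proof.
elim: w => [|a w IH]; first by rewrite app0.
rewrite eval_ss_word_cons app_cons => hx.
rewrite end_mulE Ss_op_cons// IH//.
(* Membership in X passes from awx to wx by shift invariance. *)
by rewrite -(shift_app1 a (app w x)); exact: subshift_shift.
Qed.

(** Either x does not begin with a and S_a^* kills it at once, or its shift does not begin with the
    rest of the word and induction applies. *)
Lemma eval_ss_word_out w x :
  (forall y, x <> app w y) -> ev (ss_word F R w) (delta0 x) = 0.
Proof.
(* Every sequence begins with the empty word, so the base case is vacuous. *)
elim: w x => [|a w IH] x xw; first by have := xw x; rewrite app0.
rewrite eval_ss_word_cons end_mulE.
have [xa|xa] := pselect (x 0%N = a); last by rewrite Ss_op_out// linear0.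
have [hx|hx] := pselect (X x); last by rewrite (delta0_out hx) !linear0.
have xE : x = app [:: a] (shift x) by rewrite -xa app1_shift.
rewrite xE Ss_op_cons -?xE//.
by apply: IH => y yE; apply: (xw y); rewrite app_cons -yE.
Qed.

Lemma eval_rel t t' : subshift_rel t t' -> ev t = ev t'.
Proof.
case=> {t t'} [|Y Z|Y Z||a|a|u v hu hv] /=; apply: end_ext => x hx.
- by rewrite P_op_in.
- rewrite end_mulE.
  have [Zx|Zx] := pselect (proj1_sig Z x); last first.
    by rewrite (P_op_out Zx) linear0 P_op_out// => -[].
  rewrite (P_op_in Zx).
  have [Yx|Yx] := pselect (proj1_sig Y x); last by rewrite !P_op_out// => -[].
  by rewrite !P_op_in.
(* On [delta0 x] the four cases read 1 = 1+1-1, 1 = 1+0-0, 1 = 0+1-0 and 0 = 0+0-0. *)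
- rewrite !end_addE end_oppE.
  have [Yx|Yx] := pselect (proj1_sig Y x);
  have [Zx|Zx] := pselect (proj1_sig Z x).
  + have YZx : proj1_sig (UsetU Y Z) x by left.
    by rewrite (P_op_in YZx) (P_op_in Yx) (P_op_in Zx) P_op_in ?addrK.
  + have YZx : proj1_sig (UsetU Y Z) x by left.
    rewrite (P_op_in YZx) (P_op_in Yx) (P_op_out Zx) P_op_out; last by case.
    by rewrite addr0 subr0.
  + have YZx : proj1_sig (UsetU Y Z) x by right.
    rewrite (P_op_in YZx) (P_op_out Yx) (P_op_in Zx) P_op_out; last by case.
    by rewrite add0r subr0.
  + rewrite (P_op_out Yx) (P_op_out Zx) !P_op_out; try by case.
    by rewrite addr0 subr0.
- by rewrite P_op_out.
- rewrite !end_mulE S_opE.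
  have [hax|hax] := pselect (X (app [:: a] x)); last first.
    by rewrite delta0_out ?linear0.
  by rewrite Ss_op_cons// S_opE.
- rewrite !end_mulE.
  have [xa|xa] := pselect (x 0%N = a); last by rewrite Ss_op_out// !linear0.
  have xE : x = app [:: a] (shift x) by rewrite -xa app1_shift.
  by rewrite xE Ss_op_cons -?xE// S_opE -xE xE Ss_op_cons -?xE.
- rewrite !end_mulE.
  have [xC|xC] := pselect (cyl F u v x).
    rewrite (@P_op_in (Ucyl hu hv))//; case: xC => y [hv' hu'] <-.
    (* The basis index travels from vy to y, uy, y and back to vy. *)
    by rewrite eval_ss_word_app// eval_s_word eval_ss_word_app// eval_s_word.
  rewrite (@P_op_out (Ucyl hu hv))//.
  have [[y xE]|xv] := pselect (exists y, x = app v y); last first.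
    by rewrite eval_ss_word_out ?linear0// => y xE; apply: xv; exists y.
  (* Since x = vy lies in X but not in C(u,v), the sequence uy is outside X, so S_u kills
     delta_y. *)
  rewrite xE eval_ss_word_app -?xE// eval_s_word delta0_out ?linear0// => huy.
  by apply: xC; exists y; rewrite //= -xE.
Qed.

End Representation.

Theorem proposition3p2 (A : Type) (A_nonempty : inhabited A)
    (F : set (seq A)) (R : comPzRingType) :
  exists pi : {rmorphism subshift_algebra F R -> {linear PP F R -> PP F R}},
    [/\ scalable pi,
        forall Y : boolean_algebra F, pi (alg_p R Y) = P_op R Y,
        forall a : A, pi (alg_s F R a) = S_op F R a &
        forall a : A, pi (alg_ss F R a) = Ss_op F R a].
Proof.
have [f [[fD fM f1 fZ fG] _]] := presented_lift
  (@end_scalar_central R (PP F R)) (@eval_rel A F R).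
(* The morphism structure asks for compatibility with subtraction, which follows from additivity. *)
have fB : zmod_morphism (f : subshift_algebra F R -> {linear PP F R -> PP F R}).
  by move=> u v; apply/eqP; rewrite eq_sym subr_eq -fD subrK.
pose fz := GRing.isZmodMorphism.Build _ _ _ fB.
pose fm := GRing.isMonoidMorphism.Build
  (subshift_algebra F R) {linear PP F R -> PP F R} f (conj f1 fM).
pose pi : {rmorphism subshift_algebra F R -> {linear PP F R -> PP F R}} :=
  HB.pack f fz fm.
exists pi; split=> [k u|Y|a|a]; try exact: fG.
(* [fZ] expresses scaling in the target as multiplication by [end_scalar k]. *)
by rewrite -end_scalarE; exact: fZ.
Qed.
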